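(* Let $M$ be an $\omega$-categorical structure and $F$ a field. Let $\mathcal V=\{v_1,v_2,\dots\}\subseteq FM$ be such that for every $i$, $\langle\mathcal V\rangle_{FAut(M)}\ne\langle v_1,\dots,v_{i-1}\rangle_{FAut(M)}$, and let $I=\bigcup_i supp(v_i)$. Then for every elementary extension $M'$ of $M$ there is no subset $\mathcal L\subseteq M'$ with $I\subseteq\mathcal L$, linear order $<$ on $\mathcal L$, and finite set $\mathcal P$ of non-algebraic complete $1$-types over $(\mathcal L,<)$ such that $(\mathcal L,<)$ is a quasi-well-ordering with respect to $\mathcal P$ which is nice in $M'$ with respect to $\mathcal P$.
   Context: $FM$ is the $F$-vector space with basis $M$, regarded as a module over the group algebra $FAut(M)$ via the permutation action; $\langle S\rangle_{FAut(M)}$ is the submodule generated by $S$; $supp(v)$ is the set of elements of $M$ occurring in $v$ with nonzero coefficient. Types over $\mathcal L$ are in the language of orders with parameters from $\mathcal L$; non-algebraic means not containing $x=c$, $c\in\mathcal L$; $p<q$ iff some $c\in\mathcal L$ has $(x<c)\in p$, $(c<x)\in q$. For $\mathcal P=\{p_1<\dots<p_k\}$ let $\mathcal L^{<}(p_1)=\{x:x<p_1\}$, $\mathcal L(p_l,p_{l+1})=\{x:p_l<x<p_{l+1}\}$, $\mathcal L^{>}(p_k)=\{x:p_k<x\}$ (where $c<p$ means $(c<y)\in p(y)$). For $c_1,c_2$ in such a set adjacent to $p\in\mathcal P$, $c_2<_pc_1$ means that $c_1$ lies between $c_2$ and $p$. The $\infty$-type of a well-ordering is $\{c<x:c\in\mathcal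 L\}$ (of a reverse well-ordering, $\{x<c\}$). $(\mathcal L,<)$ is quasi-well-ordered w.r.t. $\mathcal P$ if: (a) $\mathcal L$ is well-ordered and $p_k$ is its $\infty$-type; or (b) $\mathcal L$ is reverse well-ordered and $p_1$ is the $\infty$-type of the reverse order; or (c) $\mathcal L=\mathcal L_1+\mathcal L_2$ with $\mathcal L_1$ well-ordered with $\infty$-type $p_s$ and $\mathcal L_2$ reverse well-ordered with $p_s$ the $\infty$-type of its reverse. Then each nonempty set $J$ among $\mathcal L^{<}(p_1),\mathcal L(p_l,p_{l+1}),\mathcal L^{>}(p_k)$ is well-ordered by $<_p$ for exactly one of its endpoint types $p$; write $<_J$ for this order, and let $J_1,\dots,J_m$ list these sets. The quasi-well-ordering is nice in $M'$ w.r.t. $\mathcal P$ if for every sequence of tuples $(a^i_1,\dots,a^i_m)$, $i<\omega$, with $a^i_l\in J_l$ and $a^1_l\le_{J_l}a^2_l\le_{J_l}\cdots$ for each $l$, there exist $i<j$ and $\xi\in Aut(M')$ with $\xi(\bar a^i)=\bar a^j$ such that for each $l$, $\xi$ maps the $<_{J_l}$-initial segment of $J_l$ determined by $a^i_l$ into the $<_{J_l}$-initial segment determined by $a^j_l$. *)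

(* Defs.v *)
From mathcomp Require Import all_boot all_order all_algebra finmap.
From mathcomp Require Import classical_sets cardinality.
From mathcomp.multinomials Require Export monalg.

Set Implicit Arguments.
Unset Strict Implicit.
Unset Printing Implicit Defensive.

Local Open Scope classical_set_scope.
Local Open Scope ring_scope.

(** * First-order languages, structures and formulas *)

Record language : Type := Language {
  fsym : Type;
  farity : fsym -> nat;
  rsym : Type;
  rarity : rsym -> nat }.

Record structure (S : language) : Type := Structure {
  carrier :> choiceType;
  finterp : forall f : fsym S, ('I_(farity f) -> carrier) -> carrier;
  rinterp : forall r : rsym S, ('I_(rarity r) -> carrier) -> Prop }.
Arguments finterp {S} s f.
Arguments rinterp {S} s r.

(* [term S n] and [formula S n]: free variables among x_0, ..., x_(n-1).  In
   [FAll A] the bound variable is x_0 of [A], and x_(i+1) of [A] is x_i of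
   [FAll A]. *)
Inductive term (S : language) (n : nat) : Type :=
| TVar of 'I_n
| TApp (f : fsym S) of ('I_(farity f) -> term S n).
Arguments TVar {S n}.
Arguments TApp {S n} f.

Inductive formula (S : language) : nat -> Type :=
| FFalse n : formula S n
| FEq n of term S n & term S n : formula S n
| FRel n (r : rsym S) of ('I_(rarity r) -> term S n) : formula S n
| FImp n of formula S n & formula S n : formula S n
| FAll n of formula S n.+1 : formula S n.
Arguments FFalse {S n}.
Arguments FRel {S n} r.

Definition FNot S n (A : formula S n) : formula S n := FImp A FFalse.

Definition cons_env (T : Type) n (x : T) (w : 'I_n -> T) : 'I_n.+1 -> T :=
  fun i => if unlift ord0 i is Some j then w j else x.

Fixpoint teval S (M : structure S) n (w : 'I_n -> M) (t : term S n) : M :=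
  match t with
  | TVar i => w i
  | TApp f u => finterp M f (fun i => teval w (u i))
  end.

Fixpoint sat S (M : structure S) n (A : formula S n) : ('I_n -> M) -> Prop :=
  match A with
  | FFalse _ => fun _ => False
  | FEq _ t u => fun w => teval w t = teval w u
  | FRel _ r u => fun w => rinterp M r (fun i => teval w (u i))
  | FImp _ A B => fun w => sat A w -> sat B w
  | FAll _ A => fun w => forall x : M, sat A (cons_env x w)
  end.

Definition elementary_embedding S (M N : structure S) (e : M -> N) : Prop :=
  forall n (A : formula S n) (w : 'I_n -> M), sat A w <-> sat A (e \o w).

Definition elementarily_equivalent S (M N : structure S) : Prop :=
  forall A : formula S 0,
    (forall w : 'I_0 -> M, sat A w) <-> (forall w : 'I_0 -> N, sat A w).

Definition isomorphism S (M N : structure S) (g : M -> N) : Prop :=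
  [/\ bijective g,
      forall f w, g (finterp M f w) = finterp N f (g \o w) &
      forall r w, rinterp M r w <-> rinterp N r (g \o w)].

Definition automorphism S (M : structure S) (g : M -> M) : Prop :=
  isomorphism g.

Definition countable_language (S : language) : Prop :=
  countable [set: fsym S] /\ countable [set: rsym S].

Definition countably_infinite (T : Type) : Prop :=
  countable [set: T] /\ infinite_set [set: T].

Definition omega_categorical S (M : structure S) : Prop :=
  [/\ countable_language S, countably_infinite M &
      forall N : structure S, countably_infinite N ->
        elementarily_equivalent M N ->
        exists g : M -> N, isomorphism g].

(** * Complete 1-types over a structure *)

Definition with_constants (S : language) (C : Type) : language :=
  {| fsym := (fsym S + C)%type;
     farity := fun f => match f with inl f => farity f | inr _ => 0%N end;
     rsym := rsym S;
     rarity := @rarity S |}.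

Definition expansion S (N : structure S) : structure (with_constants S N) :=
  @Structure (with_constants S N) (carrier N)
    (fun f => match f return
         ('I_(@farity (with_constants S N) f) -> carrier N) -> carrier N with
       | inl f => fun w => finterp N f w
       | inr c => fun _ => c
       end)
    (fun r w => rinterp N r w).

Definition formula1 S (N : structure S) : Type :=
  formula (with_constants S N) 1.

(* Finite satisfiability in N is the same thing as consistency with the
   elementary diagram of N. *)
Definition complete_type S (N : structure S) (p : set (formula1 N)) : Prop :=
  (forall X : set (formula1 N), finite_set X -> X `<=` p ->
     exists y : N, forall A, X A -> sat (M := expansion N) A (fun=> y)) /\
  (forall A : formula1 N, p A \/ p (FNot A)).

(** * Linear orders as structures *)

Definition strict_linear_on (T : Type) (D : set T) (R : T -> T -> Prop) :
    Prop :=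
  [/\ forall x, D x -> ~ R x x,
      forall x y z, D x -> D y -> D z -> R x y -> R y z -> R x z &
      forall x y, D x -> D y -> [\/ R x y, x = y | R y x]].

Definition well_ordered_on (T : Type) (D : set T) (R : T -> T -> Prop) :
    Prop :=
  strict_linear_on D R /\
  forall B : set T, B `<=` D -> B !=set0 ->
    exists2 b, B b & forall x, B x -> x = b \/ R b x.

Definition order_language : language :=
  {| fsym := void; farity := fun=> 0%N; rsym := unit; rarity := fun=> 2 |}.

Definition order_structure (T : choiceType) (lt : T -> T -> Prop) :
    structure order_language :=
  @Structure order_language T
    (fun f : void => match f with end)
    (fun _ w => lt (w ord0) (w ord_max)).

Section OrderTypes.
Variables (T : choiceType) (lt : T -> T -> Prop).

Local Notation OT := (order_structure lt).
Local Notation lang := (with_constants order_language OT).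
Local Notation type1 := (set (formula1 OT)).

Definition var_x : term lang 1 := TVar ord0.

(* A constant has arity 0: its family of arguments is vacuous. *)
Definition const (c : T) : term lang 1 := @TApp lang 1 (inr c) (fun=> var_x).

Definition f_lt (t u : term lang 1) : formula1 OT :=
  @FRel lang 1 tt (fun i : 'I_2 => if i == ord0 then t else u).

Definition f_eq (t u : term lang 1) : formula1 OT := @FEq lang 1 t u.

Definition non_algebraic (p : type1) : Prop :=
  forall c : T, ~ p (f_eq var_x (const c)).

(* c < p and p < c for an element c and a type p *)
Definition elt_lt_type (c : T) (p : type1) : Prop := p (f_lt (const c) var_x).
Definition type_lt_elt (p : type1) (c : T) : Prop := p (f_lt var_x (const c)).

Definition type_lt (p q : type1) : Prop :=
  exists c : T, type_lt_elt p c /\ elt_lt_type c q.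

(* [lt_towards p c2 c1] is c2 <_p c1: c1 lies between c2 and p. *)
Definition lt_towards (p : type1) (c2 c1 : T) : Prop :=
  (lt c2 c1 /\ elt_lt_type c1 p) \/ (type_lt_elt p c1 /\ lt c1 c2).

(* A finite set of types p_0 < ... < p_(k-1) is given by its increasing
   enumeration. *)
Definition increasing_types k (p : 'I_k -> type1) : Prop :=
  forall i j : 'I_k, (i < j)%N -> type_lt (p i) (p j).

Section Intervals.
Variables (k : nat) (p : 'I_k -> type1).

(* The k+1 intervals cut out by p_0 < ... < p_(k-1), some possibly empty:
   [cut_interval l] is the set of the x with p_(l-1) < x < p_l, where the
   lower (upper) bound is absent for l = 0 (for l = k). *)
Definition cut_interval (l : 'I_k.+1) : set T :=
  [set x | (forall s : 'I_k, s.+1 = l -> type_lt_elt (p s) x) /\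
           (forall s : 'I_k, s = l :> nat -> elt_lt_type x (p s))].

Definition endpoint (l : 'I_k.+1) (s : 'I_k) : Prop :=
  s.+1 = l \/ s = l :> nat.

Definition infinity_type (D : set T) (q : type1) : Prop :=
  forall c, D c -> elt_lt_type c q.
Definition reverse_infinity_type (D : set T) (q : type1) : Prop :=
  forall c, D c -> type_lt_elt q c.

Local Notation gt := (fun x y => lt y x).

Definition quasi_well_ordered : Prop :=
  [\/ well_ordered_on setT lt /\
        (exists s : 'I_k, s.+1 = k /\ infinity_type setT (p s)),
      well_ordered_on setT gt /\
        (exists s : 'I_k, s = 0%N :> nat /\ reverse_infinity_type setT (p s)) |
      exists (D1 D2 : set T) (s : 'I_k),
        [/\ D1 `|` D2 = setT,
            forall x y, D1 x -> D2 y -> lt x y,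
            well_ordered_on D1 lt /\ infinity_type D1 (p s) &
            well_ordered_on D2 gt /\ reverse_infinity_type D2 (p s)]].

(* [e l] is the endpoint type for which the nonempty interval number l is
   well-ordered.  For a quasi-well-ordering such an [e] always exists. *)
Definition well_ordering_endpoints (e : 'I_k.+1 -> 'I_k) : Prop :=
  forall l, cut_interval l !=set0 ->
    endpoint l (e l) /\ well_ordered_on (cut_interval l) (lt_towards (p (e l))).

End Intervals.
End OrderTypes.

(* Only the nonempty intervals count: the entry of a tuple at an empty interval
   is irrelevant. *)
Definition nice S (M : structure S) (L : set M) (lt : L -> L -> Prop) k
    (p : 'I_k -> set (formula1 (order_structure lt))) : Prop :=
  exists2 e : 'I_k.+1 -> 'I_k, well_ordering_endpoints p e &
  let J := cut_interval p in
  let ltJ l := lt_towards (p (e l)) in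
  forall a : nat -> 'I_k.+1 -> L,
    (forall i l, J l !=set0 -> J l (a i l)) ->
    (forall i l, J l !=set0 -> a i l = a i.+1 l \/ ltJ l (a i l) (a i.+1 l)) ->
    exists (i j : nat) (xi : M -> M),
      [/\ (i < j)%N, automorphism xi,
          forall l, J l !=set0 -> xi (val (a i l)) = val (a j l) &
          forall l x, J l x -> ltJ l x (a i l) ->
            exists y : L, [/\ xi (val x) = val y, J l y & ltJ l y (a j l)]].

(** * The permutation module *)

(* The vector space with basis M is {malg F[M]}, the finitely supported
   functions from M to F, and supp is msupp. *)
Section PermutationModule.
Variables (S : language) (M : structure S) (F : fieldType).

Definition perm_act (g : M -> M) (v : {malg F[M]}) : {malg F[M]} :=
  \sum_(x <- msupp v) << v@_x *g g x >>.

(* A submodule over the group algebra of Aut(M) is a linear subspace stable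
   under Aut(M). *)
Definition aut_submodule (W : set {malg F[M]}) : Prop :=
  [/\ W 0, forall u v, W u -> W v -> W (u + v),
      forall (c : F) v, W v -> W (c *: v) &
      forall g v, automorphism g -> W v -> W (perm_act g v)].

Definition aut_span (X : set {malg F[M]}) : set {malg F[M]} :=
  smallest aut_submodule X.

End PermutationModule.

(* Main.v *)
Require Import Defs.
From mathcomp Require Import all_boot all_order all_algebra finmap.
From mathcomp Require Import boolp classical_sets cardinality filter.

(** The argument is a Groebner-style reduction.  Well-order [L] by comparing
    first the number of the interval [J_l], then the order [<_(J_l)].  Let [W n]
    be the submodule generated by the first [n] vectors; it extends to a space
    [ext (W n)] over [M'], made of the vectors whose elementary copies in [M]
    lie in [W n].  For each [n] choose [u_n], supported on [L], in the union of
    these spaces but outside [ext (W n)], with least possible leading element.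
    Bound the support of [u_n] in each interval by a tuple of elements, and pass
    to a subsequence on which these tuples increase.  Niceness yields [i < j]
    and an automorphism taking the leading element of [u_i] to that of [u_j] and
    keeping the rest of the support below it, so a multiple of the image of
    [u_i] cancels the leading term of [u_j], against minimality.

    That [ext W] is a submodule meeting [F M] in [W] uses two consequences of
    omega-categoricity: tuples of [M'] have elementary copies in [M] (downward
    Loewenheim-Skolem), and tuples of [M] of the same type are conjugate.  For
    the latter, an ultrapower of [M] is homogeneous, hence so is some countable
    elementary substructure of it, which is a copy of [M]. *)

Set Implicit Arguments.
Unset Strict Implicit.
Unset Printing Implicit Defensive.

Import GRing.Theory.
Local Open Scope classical_set_scope.
Local Open Scope ring_scope.

(** * Countability of the set of formulas *)

Section Coding.
Variables (S : language) (cf : Defs.fsym S -> nat) (cr : rsym S -> nat).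
Hypotheses (cf_inj : injective cf) (cr_inj : injective cr).

Local Notation leaf i := (@GenTree.Leaf nat i).

Fixpoint term_code n (t : term S n) : GenTree.tree nat :=
  match t with
  | TVar i => leaf (nat_of_ord i)
  | TApp f u =>
      GenTree.Node (cf f) [seq term_code (u i) | i <- enum 'I_(farity f)]
  end.

Lemma term_code_inj n : injective (@term_code n).
Proof.
elim=> [i|f u IH] [j|g w] //=.
  by case=> /ord_inj ->.
case=> /cf_inj fg; case: g / fg w => w /eq_in_map uw.
by congr TApp; apply/funext => i; apply: IH; apply: uw; rewrite mem_enum.
Qed.

(** Labels 0, 1 and 2 are taken by equality, implication and the quantifier, so the codes of
    relation symbols are shifted by three. *)
Fixpoint formula_code n (A : formula S n) : GenTree.tree nat :=
  match A with
  | FFalse _ => leaf 0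
  | FEq _ t u => GenTree.Node 0 [:: term_code t; term_code u]
  | FRel _ r u => GenTree.Node (cr r).+3
                    [seq term_code (u i) | i <- enum 'I_(rarity r)]
  | FImp _ A B => GenTree.Node 1 [:: formula_code A; formula_code B]
  | FAll _ A => GenTree.Node 2 [:: formula_code A]
  end.

Lemma formula_code_inj n : injective (@formula_code n).
Proof.
move=> A; elim: {n} A => [n|n t u|n r u|n A IHA A' IHA'|n A IHA] B;
  [case: B|case: n / B t u|case: n / B u|case: n / B A A' IHA IHA'|
   case: n / B A IHA] => //=.
- by move=> n t u t' u' [/term_code_inj-> /term_code_inj->].
- move=> n r' u' u [/cr_inj rr]; case: r' / rr u' => u' /eq_in_map uu.
  congr FRel; apply/funext => i; apply: term_code_inj.
  by apply: uu; rewrite mem_enum.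
- by move=> n B B' A A' IHA IHA' [/IHA-> /IHA'->].
- by move=> n B A IHA [/IHA->].
Qed.

End Coding.

Lemma countable_code (T : Type) :
  countable [set: T] -> exists c : T -> nat, injective c.
Proof.
by move=> /countable_injP[c /in2TT cI]; exists c.
Qed.

Lemma countable_enumeration (T : Type) (x0 : T) : countable [set: T] ->
  exists b : nat -> T, forall x, exists i, b i = x.
Proof.
move=> /countable_code[c cI].
have ex i : exists x, forall y, c y = i -> x = y.
  have [[y <-]|none] := pselect (exists y, c y = i); first by exists y => z /cI.
  by exists x0 => y cy; exfalso; apply: none; exists y.
by have [b bP] := choice ex; exists b => x; exists (c x); apply: bP.
Qed.

Lemma countable_formulas (S : language) : countable_language S ->
  exists c : forall n, formula S n -> nat, forall n, injective (c n).
Proof.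
move=> [/countable_code[cf cfI] /countable_code[cr crI]].
exists (fun n A => choice.pickle (formula_code cf cr A)) => n A B.
by move=> /(pcan_inj choice.pickleK)/(formula_code_inj cfI crI).
Qed.

(** * Elementary embeddings *)

Lemma cons_env0 T n (x : T) (w : 'I_n -> T) : cons_env x w ord0 = x.
Proof. by rewrite /cons_env unlift_none. Qed.

Lemma cons_envS T n (x : T) (w : 'I_n -> T) i :
  cons_env x w (lift ord0 i) = w i.
Proof. by rewrite /cons_env liftK. Qed.

Lemma comp_cons_env T U (f : T -> U) n (x : T) (w : 'I_n -> T) :
  f \o cons_env x w = cons_env (f x) (f \o w).
Proof. by apply/funext => i; rewrite /cons_env /=; case: unlift. Qed.

Lemma cons_env_nth T (d x : T) s :
  cons_env x (fun i : 'I_(size s) => nth d s i) =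
  (fun i : 'I_(size s).+1 => nth d (x :: s) i).
Proof.
by apply/funext=> i; rewrite /cons_env; case: unliftP => [j|] ->.
Qed.

Definition FEx S n (A : formula S n.+1) : formula S n := FNot (FAll (FNot A)).

Lemma sat_ex S (N : structure S) n (A : formula S n.+1) (w : 'I_n -> N) :
  sat (FEx A) w <-> exists x, sat A (cons_env x w).
Proof.
split=> [/= nall|[x Ax] nall]; last exact: nall Ax.
by apply: contrapT => nex; apply: nall => x Ax; apply: nex; exists x.
Qed.

Lemma elementary_embedding_inj S (N N' : structure S) (e : N -> N') :
  elementary_embedding e -> injective e.
Proof.
move=> eE x y exy.
have /= := eE 2 (FEq (TVar ord0) (TVar (lift ord0 ord0)))
  (cons_env x (fun=> y)).
by rewrite !cons_env0 !cons_envS exy => /iffRL; apply.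
Qed.

Lemma elementary_embedding_comp S (N1 N2 N3 : structure S)
    (e : N1 -> N2) (f : N2 -> N3) :
  elementary_embedding e -> elementary_embedding f ->
  elementary_embedding (f \o e).
Proof.
by move=> eE fE n A w; rewrite (eE n A w) (fE n A (e \o w)).
Qed.

Lemma isomorphism_elementary S (N N' : structure S) (g : N -> N') :
  isomorphism g -> elementary_embedding g.
Proof.
move=> [gB gf gr].
have gt n (w : 'I_n -> N) t : g (teval w t) = teval (g \o w) t.
  elim: t => //= f u IH; rewrite gf; congr finterp.
  by apply/funext => i /=; rewrite IH.
move=> n; elim=> {n} [n|n t u|n r u|n A IHA B IHB|n A IHA] w //=.
- by rewrite -!gt; split=> [->//|/(bij_inj gB)].
- rewrite gr; have -> : g \o (fun i => teval w (u i)) =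
    (fun i => teval (g \o w) (u i)) by apply/funext => i /=; rewrite gt.
  by [].
- by rewrite (IHA w) (IHB w).
- split=> [H x|H x]; last by rewrite IHA comp_cons_env; apply: H.
  case: gB => h gK hK; have := H (h x).
  by rewrite IHA comp_cons_env hK.
Qed.

(** Both theories coincide with that of [N3]. The empty assignment exists and is unique over any
    type, so truth of a sentence passes along an embedding. *)
Lemma elementary_equivalent_spans S (N1 N2 N3 : structure S)
    (e : N1 -> N3) (f : N2 -> N3) :
  elementary_embedding e -> elementary_embedding f ->
  elementarily_equivalent N1 N2.
Proof.
have w0 T (w w' : 'I_0 -> T) : w = w' by apply/funext => -[].
have sentE (N N' : structure S) (h : N -> N') (hE : elementary_embedding h)
    (A : formula S 0) :
    (forall w : 'I_0 -> N, sat A w) <-> (forall w : 'I_0 -> N', sat A w).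
  have u T : 'I_0 -> T by case.
  by split=> H w; [rewrite (w0 _ w (h \o u _)); apply/hE|apply/hE].
by move=> eE fE A; rewrite (sentE _ _ _ eE) (sentE _ _ _ fE).
Qed.

(** * Downward Loewenheim-Skolem *)

Section Closure.
Variables (T : Type) (G : nat -> seq T -> T) (a : nat -> T).

(** Trees serve as formal expressions: a leaf names a constant and a node labelled [j] applies
    [G j]. There are countably many of them, hence countably many values. *)
Fixpoint generated (t : GenTree.tree nat) : T :=
  match t with
  | GenTree.Leaf i => a i
  | GenTree.Node j ts => G j [seq generated t | t <- ts]
  end.

Lemma countable_closure : exists D : set T,
  [/\ countable D, forall i, D (a i) &
      forall j s, (forall i : 'I_(size s), D (tnth (in_tuple s) i)) ->
        D (G j s)].
Proof.
exists (range generated); split.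
- by apply: (sub_countable (card_image_le _ _)); apply: countableP.
- by move=> i; exists (GenTree.Leaf i).
move=> j s Ds.
suff [ts <-] : exists ts, map generated ts = s by exists (GenTree.Node j ts).
elim: s Ds => [|x s IH] Ds; first by exists [::].
have [t _ tx] := Ds ord0.
have [i|ts tsE] := IH; last by exists (t :: ts); rewrite /= tsE tx (tnth_nth x).
have := Ds (lift ord0 i).
by rewrite !(tnth_nth x).
Qed.

End Closure.

Lemma size_ord_map T n (w : 'I_n -> T) : size [seq w i | i <- enum 'I_n] = n.
Proof. by rewrite size_map size_enum_ord. Qed.

Lemma nth_ord_map T n (w : 'I_n -> T) d (i : 'I_n) :
  nth d [seq w j | j <- enum 'I_n] i = w i.
Proof. by rewrite (nth_map i) ?size_enum_ord // nth_ord_enum. Qed.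

Section Skolem.
Variables (S : language) (N : structure S) (D : set N).

Definition tarski_vaught : Prop :=
  forall n (A : formula S n.+1) (w : 'I_n -> N), (forall i, D (w i)) ->
  (exists x, sat A (cons_env x w)) -> exists2 x, D x & sat A (cons_env x w).

Hypothesis DTV : tarski_vaught.

Lemma tarski_vaught_fun f (w : 'I_(farity f) -> N) :
  (forall i, D (w i)) -> D (finterp N f w).
Proof.
move=> Dw.
(* The formula x_0 = f(x_1, ..., x_n) has [finterp N f w] as its only solution, so the witness in
   [D] must be this value. *)
have [] := DTV (A := FEq (TVar ord0) (TApp f (fun i => TVar (lift ord0 i)))) Dw.
  exists (finterp N f w) => /=; rewrite cons_env0; congr finterp.
  by apply/funext=> i; rewrite cons_envS.
move=> x Dx /=; rewrite cons_env0 => xE.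
suff -> : finterp N f w = x by [].
by rewrite xE; congr finterp; apply/funext=> i; rewrite cons_envS.
Qed.

Local Notation carr := {x : N | `[< D x >]}.

Let inD (x : carr) : D (val x). Proof. exact/asboolP/(valP x). Qed.

Definition substructure : structure S :=
  @Structure S carr
    (fun f w => exist (fun x => `[< D x >]) (finterp N f (val \o w))
       (asboolT (tarski_vaught_fun (fun i => inD (w i)))))
    (fun r w => rinterp N r (val \o w)).

Definition subval (x : substructure) : N := val x.

Lemma subvalP (x : substructure) : D (subval x).
Proof. exact: inD. Qed.

Lemma subval_onto x : D x -> exists y, subval y = x.
Proof. by move=> /asboolT Dx; exists (exist (fun x => `[< D x >]) x Dx). Qed.

Lemma subval_elementary : elementary_embedding subval.
Proof.
have tE n (w : 'I_n -> substructure) t :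
    subval (teval w t) = teval (subval \o w) t.
  elim: t => //= f u IH; congr finterp.
  by apply/funext => i /=; rewrite -IH.
move=> n; elim=> {n} [n|n t u|n r u|n A IHA B IHB|n A IHA] w //=.
- by rewrite -!tE; split=> [->//|/val_inj].
- have -> : val \o (fun i => teval w (u i)) =
    (fun i => teval (subval \o w) (u i)) by apply/funext => i /=; rewrite -tE.
  by [].
- by rewrite (IHA w) (IHB w).
- split=> [H x|H x]; last by rewrite IHA comp_cons_env; apply: H.
  (* Only the quantifier uses the Tarski-Vaught condition: a counterexample in [N] yields one in
     [D]. *)
  apply: contrapT => nA.
  have [] := @DTV _ (FNot A) (subval \o w) (fun i => inD (w i)).
    by exists x.
  move=> y Dy; apply.
  have := H (exist _ y (asboolT Dy) : substructure).
  by rewrite IHA comp_cons_env.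
Qed.

End Skolem.

(** [D] is the closure of the sequence [a] under Skolem functions and under the extra operation [H].
    Through [H], properties of [N] witnessed by an operation on finite tuples descend to [D]. *)
Lemma lowenheim_skolem S (N : structure S) (H : seq N -> N) (a : nat -> N) :
  countable_language S ->
  exists D : set N, [/\ countable D, forall i, D (a i), tarski_vaught D &
    forall s, (forall i : 'I_(size s), D (tnth (in_tuple s) i)) -> D (H s)].
Proof.
move=> /countable_formulas[c cI].
(* Here [j] codes a formula and [s] lists its parameters. The arity is recovered from the length of
   [s], so one operation for each [j] serves all arities. *)
pose skolem (j : nat) (s : seq N) (x : N) :=
  forall n (A : formula S n.+1) (w : 'I_n -> N), c _ A = j ->
    s = [seq w i | i <- enum 'I_n] ->
    (exists x, sat A (cons_env x w)) -> sat A (cons_env x w).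
have ex j s : exists x, skolem j s x.
  have [[n [A [w [cA sE [x xA]]]]]|none] := pselect (exists n
      (A : formula S n.+1) (w : 'I_n -> N), [/\ c _ A = j,
        s = [seq w i | i <- enum 'I_n] & exists x, sat A (cons_env x w)]).
    exists x => n' A' w' cA' sE' _.
    have nn : n = n'.
      by have := congr1 size (etrans (esym sE) sE'); rewrite !size_ord_map.
    case: n' / nn A' w' cA' sE' => A' w' cA' sE'.
    have /cI -> : c _ A' = c _ A by rewrite cA cA'.
    suff -> : w' = w by [].
    have /eq_in_map ww := etrans (esym sE') sE.
    by apply/funext=> i; apply: ww; rewrite mem_enum.
  exists (a 0) => n A w cA sE xA; exfalso; apply: none.
  by exists n, A, w.
have [sk skP] := choice (fun js : nat * seq N => ex js.1 js.2).
(* Label 0 stands for [H], and label [j.+1] for the Skolem function of the formula coded by [j]. *)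
have [D [Dc Da DG]] := countable_closure
  (fun j s => if j is j'.+1 then sk (j', s) else H s) a.
exists D; split => //.
  move=> n A w Dw xA; set s := [seq w i | i <- enum 'I_n].
  exists (sk (c _ A, s)); last exact: (skP (_, _)) xA.
  apply: (DG _.+1) => i; have : tnth (in_tuple s) i \in s by apply: mem_tnth.
  by move=> /mapP[k _ ->].
exact: (DG 0).
Qed.

(** A countable elementary substructure of [N] containing the image of [e] is infinite and
    elementarily equivalent to [M], hence isomorphic to [M]. The map [f] is this isomorphism
    followed by the inclusion. *)
Lemma categorical_reflection S (M N : structure S) (e : M -> N)
    (H : seq N -> N) k (a : 'I_k -> N) :
  omega_categorical M -> elementary_embedding e ->
  exists f : M -> N, [/\ elementary_embedding f,
    forall i, exists m, f m = a i & forall s, exists m, f m = H (map f s)].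
Proof.
move=> [Sc [Mc Minf] cat] eE.
have [x0 _] : [set: M] !=set0 by apply: infinite_setN0.
have [b bP] := countable_enumeration x0 Mc.
(* The first [k] terms are the prescribed points; the following ones enumerate the image of [e]. *)
pose a' i := if (i < k)%N =P true is ReflectT ik then a (Ordinal ik)
             else e (b (i - k)%N).
have [D [Dc Da DTV DH]] := lowenheim_skolem H a' Sc.
have De m : D (e m).
  have [i <-] := bP m; have := Da (i + k)%N; rewrite /a'.
  by case: eqP; rewrite ?addnK // => ik; have := ik; rewrite ltnNge leq_addl.
have DaE i : D (a i).
  have := Da i; rewrite /a'; case: eqP => [ik|]; last by rewrite ltn_ord.
  by have -> : Ordinal ik = i by apply: val_inj.
pose N' := substructure DTV; pose v := @subval _ _ _ DTV.
have vE : elementary_embedding v by apply: subval_elementary.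
have N'inf : countably_infinite N'.
  split.
    have /countable_injP[c cI] := Dc.
    apply/countable_injP; exists (c \o v) => x y _ _ /cI xy.
    by apply: (elementary_embedding_inj vE); apply: xy;
      rewrite inE; apply: subvalP.
  have [g gP] := choice (fun m => subval_onto DTV (De m)).
  move=> N'fin; apply: Minf.
  apply: (@sub_finite_set _ _ (g @^-1` setT)) => //.
  apply: finite_preimage => // x y _ _ /(congr1 v); rewrite /v !gP.
  exact: (elementary_embedding_inj eE).
have [h hI] := cat N' N'inf (elementary_equivalent_spans eE vE).
have [[h' hK h'K] _ _] := hI.
exists (v \o h); split.
- exact: elementary_embedding_comp (isomorphism_elementary hI) vE.
- move=> i; have [y <-] := subval_onto DTV (DaE i).
  by exists (h' y); rewrite /= h'K.
move=> s; have Ds : D (H (map (v \o h) s)).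
  apply: DH => i; have := mem_tnth i (in_tuple (map (v \o h) s)).
  by move=> /mapP[m _ ->]; apply: subvalP.
have [y <-] := subval_onto DTV Ds.
by exists (h' y); rewrite /= h'K.
Qed.

(** * Ultrapowers and homogeneity *)

Lemma nonprincipal_ultrafilter : exists U : set_system nat,
  UltraFilter U /\ forall m, U [set i | (m <= i)%N].
Proof.
have [U [UU subU]] := ultraFilterLemma eventually_filter.
exists U; split => // m; apply: subU; by exists m.
Qed.

Section Ultrapower.
Variables (S : language) (M : structure S) (U : set_system nat).
Hypothesis UU : UltraFilter U.

Let UP : ProperFilter U. Proof. exact: ultra_proper. Qed.
#[local] Existing Instance UP.

Lemma ultra_imply (P Q : set nat) : U [set i | P i -> Q i] <-> (U P -> U Q).
Proof.
split=> [UPQ UP0|UPQ]; first by apply: filterS2 UPQ UP0 => i /=.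
have [/UPQ|] := in_ultra_setVsetC P UU; apply: filterS => i /=.
  by move=> Qi _.
by move=> nP /nP.
Qed.

Lemma ultra_not (P : set nat) : ~ U P -> U (~` P).
Proof. by have [] := in_ultra_setVsetC P UU. Qed.

(** Elements of the ultrapower are equivalence classes modulo [U], kept as sets of sequences; [rep]
    picks a representative of each. *)
Definition germ (f : nat -> M) : set (nat -> M) :=
  [set g | U [set i | f i = g i]].

Lemma germ_eq f g : germ f = germ g <-> U [set i | f i = g i].
Proof.
split=> [fg|Ufg].
  have : germ g g by apply: (filterS _ filterT).
  by rewrite -fg.
apply/seteqP; split=> h; apply: filterS2 Ufg => i /=; by move=> ->.
Qed.

Local Notation carr := {x : set (nat -> M) | `[< exists f, x = germ f >]}.

Let up0 (f : nat -> M) : carr :=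
  exist (fun x => `[< exists f, x = germ f >]) (germ f)
    (asboolT (ex_intro _ f erefl)).

Let rep0 (x : carr) : nat -> M := projT1 (cid (asboolW (valP x))).

Definition ultrapower : structure S :=
  @Structure S carr
    (fun f w => up0 (fun i => finterp M f (fun j => rep0 (w j) i)))
    (fun r w => U [set i | rinterp M r (fun j => rep0 (w j) i)]).

Definition up (f : nat -> M) : ultrapower := up0 f.
Definition rep (x : ultrapower) : nat -> M := rep0 x.

Lemma repK (x : ultrapower) : up (rep x) = x.
Proof.
apply: val_inj => /=; rewrite /rep /rep0.
by case: cid.
Qed.

Lemma up_eq f g : up f = up g <-> U [set i | f i = g i].
Proof.
by rewrite -germ_eq; split=> [/(congr1 val)|fg] //; apply: val_inj.
Qed.

Lemma rep_up f : U [set i | rep (up f) i = f i].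
Proof. by apply/up_eq; rewrite repK. Qed.

(** This is Los's theorem. The ultrafilter property settles implication, and a choice of
    counterexamples at each coordinate settles the quantifier. *)
Lemma los n (A : formula S n) (w : 'I_n -> ultrapower) :
  sat A w <-> U [set i | sat A (fun j => rep (w j) i)].
Proof.
have tE m (v : 'I_m -> ultrapower) t :
    U [set i | rep (teval v t) i = teval (fun j => rep (v j) i) t].
  elim: t => [j|f u IH] /=; first by apply: (filterS _ filterT).
  apply: filterS2
    (rep_up (fun i => finterp M f (fun j => rep (teval v (u j)) i)))
    (filter_forall UP IH) => i /= -> uE.
  by congr finterp; apply/funext=> j; apply: uE.
elim: n / A w => [n|n t u|n r u|n A IHA B IHB|n A IHA] w /=.
- by split=> // /filter_ex[].
- split=> [tu|Utu].
    by apply: filterS2 (tE _ w t) (tE _ w u) => i /= <- <-; rewrite tu.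
  rewrite -(repK (teval w t)) -(repK (teval w u)); apply/up_eq.
  by apply: filterS3 (tE _ w t) (tE _ w u) Utu => i /= -> -> ->.
- have uE : U [set i | (fun j => rep (teval w (u j)) i) =
      (fun j => teval (fun l => rep (w l) i) (u j))].
    apply: filterS (filter_forall UP (fun j => tE _ w (u j))) => i /= H.
    exact/funext.
  by split; apply: filterS2 uE => i /=; [move=> <-|move=> ->].
- by rewrite IHA IHB -ultra_imply.
- have cE x i : (fun j => rep (cons_env x w j) i) =
      cons_env (rep x i) (fun j => rep (w j) i).
    exact: (comp_cons_env (fun y => rep y i)).
  split=> [H|H x]; last first.
    by rewrite IHA; apply: filterS H => i /= H; rewrite cE.
  apply: contrapT => /ultra_not UN.
  (* At coordinates where the universal statement holds any value will do; a failing coordinate [i0]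
     supplies an element of [M]. *)
  have ex i : exists x,
      ~ (forall x, sat A (cons_env x (fun j => rep (w j) i))) ->
      ~ sat A (cons_env x (fun j => rep (w j) i)).
    have [/existsNP[x nx]|nn] := pselect (~ (forall x,
      sat A (cons_env x (fun j => rep (w j) i)))); first by exists x.
    by have [i0 /existsNP[x _]] := filter_ex UN; exists x.
  have [x xP] := choice ex.
  have := H (up x); rewrite IHA => UA.
  have [i [/= Ai [ri nA]]] := filter_ex (filterI UA (filterI (rep_up x) UN)).
  by apply: (xP i nA); rewrite -ri -cE.
Qed.

Lemma diagonal_elementary : elementary_embedding (fun x => up (fun=> x)).
Proof.
move=> n A w; rewrite los.
have wE : U [set i | (fun j => rep (up (fun=> w j)) i) = w].
  apply: filterS (filter_forall UP (fun j => rep_up (fun=> w j))) => i /= H.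
  exact/funext.
split=> [Aw|UA]; first by apply: filterS wE => i /= ->.
by have [i [/= wi Ai]] := filter_ex (filterI wE UA); rewrite -wi.
Qed.

End Ultrapower.

Definition same_type S (N N' : structure S) n (w : 'I_n -> N)
    (w' : 'I_n -> N') : Prop :=
  forall A : formula S n, sat A w <-> sat A w'.

(** By injectivity of [c], at most one formula of [X] is added at each stage. [B] is fixed before
    the structure, so it can be evaluated both in an ultrapower and in [M]. *)
Lemma finite_conjunction S n (X : set (formula S n)) (c : formula S n -> nat)
    (m : nat) : injective c ->
  exists B : formula S n, forall (N : structure S) (w : 'I_n -> N),
    sat B w <-> (forall A, X A -> (c A < m)%N -> sat A w).
Proof.
move=> cI; elim: m => [|m [B BP]].
  by exists (FNot FFalse) => N w; split=> // _ [].
have [[A XA cA]|nA] := pselect (exists2 A, X A & c A = m); last first.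
  exists B => N w; rewrite BP; split=> H A XA cA; apply: H => //.
    rewrite ltn_neqAle -ltnS cA andbT; apply/negP => /eqP cAm.
    by apply: nA; exists A.
  exact: leq_trans cA _.
exists (FNot (FImp A (FNot B))) => N w /=; rewrite BP; split=> [H A' XA' cA'|H].
  have [AA' | AA'] := pselect (A = A').
    by apply: contrapT => nA'; apply: H; rewrite AA' => /nA'.
  apply: contrapT => nA'; apply: H => _ H; apply/nA'/(H _ XA').
  rewrite ltn_neqAle -ltnS cA' andbT -cA.
  by apply/negP => /eqP /cI /esym.
apply; first by apply: H => //; rewrite cA.
by move=> A' XA' cA'; apply: H => //; apply: leq_trans cA' _.
Qed.

(** This is countable saturation. The type of [b] over [w] is exhausted by finite conjunctions
    [B m], each satisfiable over [w'] at almost all coordinates, and a diagonal choice of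
    coordinates realizes all of them at once. *)
Lemma ultrapower_homogeneous S (M : structure S) (U : set_system nat)
    (UU : UltraFilter U) n (w w' : 'I_n -> ultrapower M U) b :
  countable_language S -> (forall m, U [set i | (m <= i)%N]) ->
  same_type w w' -> exists b', same_type (cons_env b w) (cons_env b' w').
Proof.
move=> /countable_formulas[c cI] Ucof ww'.
have UP : ProperFilter U by apply: ultra_proper.
pose X := [set A : formula S n.+1 | sat A (cons_env b w)].
have [B BP] := choice (fun m => @finite_conjunction _ _ X (c n.+1) m (@cI _)).
pose w'_ i : 'I_n -> M := fun j => rep (w' j) i.
have BU m : U [set i | exists x, sat (B m) (cons_env x (w'_ i))].
  have : sat (FEx (B m)) w'.
    by apply/ww'/sat_ex; exists b; apply/BP.
  by rewrite los; apply: filterS => i /= /sat_ex.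
(* Since [B k.+1] implies the earlier conjunctions, a solution of the last satisfiable one solves
   all satisfiable ones up to [k]. *)
have ex i k : exists x, forall m, (m <= k)%N ->
    (exists y, sat (B m) (cons_env y (w'_ i))) ->
    sat (B m) (cons_env x (w'_ i)).
  elim: k => [|k [x xP]].
    have [_ [y _]] := filter_ex (BU 0); exists y => m.
    rewrite leqn0 => /eqP-> _.
    by apply/BP.
  have [[y yP]|none] := pselect (exists y, sat (B k.+1) (cons_env y (w'_ i))).
    exists y => m mk _; apply/BP => A XA cA.
    by move: yP => /BP/(_ A XA); apply; apply: leq_trans cA mk.
  exists x => m; rewrite leq_eqVlt => /predU1P[->|]; last exact: xP.
  by move=> /none.
(* Diagonal choice: coordinate [i] takes care of the conjunctions up to [B i], so each fixed one is
   handled at all large coordinates. *)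
have [x xP] := choice (fun i => ex i i).
have XA A : X A -> sat A (cons_env (up U x) w').
  move=> XA; rewrite los.
  have := BU (c _ A).+1.
  apply: filterS3 (Ucof (c _ A).+1) (rep_up UU x) => i /= ci ri /(xP _ _ ci).
  rewrite -ri BP => /(_ A XA (ltnSn _)).
  by rewrite -[cons_env _ _](comp_cons_env (fun y => rep y i) (up U x) w').
exists (up U x) => A; split; first exact: XA.
(* The converse implication comes from applying the first one to the negation of [A]. *)
move=> A'; apply: contrapT => nA.
by have := XA (FNot A) nA; apply.
Qed.

(** Homogeneity of the ultrapower is turned into an operation [H] returning the required [b']. A
    copy of [M] closed under [H] is homogeneous as well. *)
Lemma categorical_homogeneous S (M : structure S) n (w w' : 'I_n -> M) b :
  omega_categorical M -> same_type w w' ->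
  exists b', same_type (cons_env b w) (cons_env b' w').
Proof.
move=> Mcat ww'.
have [Sc [_ Minf] _] := Mcat.
have [U [UU Ucof]] := nonprincipal_ultrafilter.
pose N := ultrapower M U.
have [x0 _] : [set: M] !=set0 by apply: infinite_setN0.
pose d : N := up U (fun=> x0).
(* An input of [H] is a list made of [b], then [w], then [w']; the two tuples start at positions 1
   and [n.+1]. *)
pose tup (s : seq N) k : 'I_n -> N := fun i => nth d s (k + i).
have ex s : exists b', same_type (tup s 1%N) (tup s n.+1) ->
    same_type (cons_env (nth d s 0) (tup s 1%N)) (cons_env b' (tup s n.+1)).
  have [/(ultrapower_homogeneous UU (nth d s 0) Sc Ucof)[b' b'P]|] :=
    pselect (same_type (tup s 1%N) (tup s n.+1)); first by exists b'.
  by exists d.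
have [H HP] := choice ex.
have [f [fE _ fH]] := categorical_reflection H (fun i : 'I_0 => d) Mcat
  (@diagonal_elementary _ M _ UU).
pose s := b :: [seq w i | i <- enum 'I_n] ++ [seq w' i | i <- enum 'I_n].
have [b' b'E] := fH s; exists b' => A.
have fs : map f s =
    f b :: map f (map w (enum 'I_n)) ++ map f (map w' (enum 'I_n)).
  by rewrite /= map_cat.
have s1 : tup (map f s) 1%N = f \o w.
  apply/funext=> i; rewrite /tup fs /= add0n nth_cat size_map size_ord_map.
  rewrite ltn_ord.
  by rewrite (nth_map (w i)) ?size_ord_map // nth_ord_map.
have s2 : tup (map f s) n.+1 = f \o w'.
  apply/funext=> i; rewrite /tup fs /= nth_cat size_map size_ord_map.
  rewrite ltnNge leq_addr /= addKn.
  by rewrite (nth_map (w' i)) ?size_ord_map // nth_ord_map.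
rewrite (fE _ _ (cons_env b w)) (fE _ _ (cons_env b' w')) !comp_cons_env b'E.
have := HP (map f s); rewrite s1 s2; apply=> C.
by rewrite -(fE _ C) -(fE _ C).
Qed.

(** * Back and forth *)

Section BackAndForth.
Variables (S : language) (M : structure S).
Hypothesis homog : forall n (w w' : 'I_n -> M) b,
  same_type w w' -> exists b', same_type (cons_env b w) (cons_env b' w').
Variables (x0 : M) (b : nat -> M).
Hypothesis b_onto : forall x, exists i, b i = x.

(** A finite partial elementary map of [M], given by the list of its pairs. The default pair is
    never read. *)
Definition elementary_graph (s : seq (M * M)) : Prop :=
  same_type (fun i : 'I_(size s) => (nth (x0, x0) s i).1)
            (fun i : 'I_(size s) => (nth (x0, x0) s i).2).

Lemma elementary_graph_cons x y s :
  elementary_graph ((x, y) :: s) <->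
  same_type (cons_env x (fun i : 'I_(size s) => (nth (x0, x0) s i).1))
            (cons_env y (fun i : 'I_(size s) => (nth (x0, x0) s i).2)).
Proof.
have E (p : M * M -> M) :
    (fun i : 'I_(size s).+1 => p (nth (x0, x0) ((x, y) :: s) i)) =
    cons_env (p (x, y)) (fun i : 'I_(size s) => p (nth (x0, x0) s i)).
  by rewrite -(comp_cons_env p) cons_env_nth.
by rewrite /elementary_graph /= !E.
Qed.

Lemma elementary_graph_extend s x : elementary_graph s ->
  exists s', [/\ elementary_graph s', {subset s <= s'},
    exists y, (x, y) \in s' & exists y, (y, x) \in s'].
Proof.
move=> sE.
have [y /elementary_graph_cons yE] := homog x sE.
(* The step back: homogeneity is used with the two coordinates exchanged, to find a preimage of
   [x]. *)
have /(homog x)[z zE] : same_type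
    (fun i : 'I_(size ((x, y) :: s)) => (nth (x0, x0) ((x, y) :: s) i).2)
    (fun i : 'I_(size ((x, y) :: s)) => (nth (x0, x0) ((x, y) :: s) i).1).
  by move=> A; rewrite (yE A).
exists [:: (z, x), (x, y) & s]; split.
- by apply/elementary_graph_cons => A; rewrite (zE A).
- by move=> p ps; rewrite !inE ps !orbT.
- by exists y; rewrite !inE eqxx orbT.
- by exists z; rewrite !inE eqxx.
Qed.

Lemma elementary_graph_automorphism s : elementary_graph s ->
  exists2 g : M -> M, automorphism g & forall x y, (x, y) \in s -> g x = y.
Proof.
move=> sE.
have ex (t : seq (M * M)) i : exists t', elementary_graph t ->
    [/\ elementary_graph t', {subset t <= t'},
    exists y, (b i, y) \in t' & exists y, (y, b i) \in t'].
  have [/(elementary_graph_extend (b i))[t' t'P]|] :=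
    pselect (elementary_graph t).
    by exists t'.
  by exists t.
have [next nextP] := choice (fun ti : seq (M * M) * nat => ex ti.1 ti.2).
(* Stage [i.+1] puts [b i] into both the domain and the range; the automorphism has the union [G] of
   the stages as its graph. *)
pose st := fix st i := if i is i'.+1 then next (st i', i') else s.
have stE i : elementary_graph (st i).
  by elim: i => //= i IH; have [] := nextP (st i, i) IH.
have stS i j : (i <= j)%N -> {subset st i <= st j}.
  move=> /subnK <-; elim: (j - i)%N => //= k IH p /IH pk.
  by have [_ sub _ _] := nextP (st (k + i)%N, (k + i)%N) (stE _); apply: sub.
pose G x y := exists i, (x, y) \in st i.
(* Finitely many pairs of [G] all occur in the stage numbered by the maximum of their stages. *)
have finG n (w w' : 'I_n -> M) : (forall i, G (w i) (w' i)) ->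
    exists k (h : 'I_n -> 'I_(size (st k))), forall i,
      nth (x0, x0) (st k) (h i) = (w i, w' i).
  move=> /choice[k kP]; exists (\max_i k i)%N.
  have ex' i : exists h : 'I_(size (st (\max_i k i)%N)),
      nth (x0, x0) (st (\max_i k i)%N) h = (w i, w' i).
    have wst := stS _ _ (leq_bigmax i) _ (kP i).
    have lt := wst; rewrite -index_mem in lt.
    by exists (Ordinal lt); rewrite /= nth_index.
  by have [h hP] := choice ex'; exists h.
(* The last premise asks for the renaming of the variables of [A] along [h], so that [A] can be read
   on the whole list of a stage. It is supplied below for atomic formulas. *)
have atomic n (A : formula S n) : forall w w' : 'I_n -> M,
    (forall i, G (w i) (w' i)) ->
    (forall m (h : 'I_n -> 'I_m), exists A' : formula S m,
      forall u : 'I_m -> M, sat A' u <-> sat A (u \o h)) ->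
    (sat A w <-> sat A w').
  move=> w w' /finG[k [h hE]] /(_ _ h)[A' A'E].
  have <- : (fun i : 'I_(size (st k)) => (nth (x0, x0) (st k) i).1) \o h = w.
    by apply/funext=> i; rewrite /= hE.
  have <- : (fun i : 'I_(size (st k)) => (nth (x0, x0) (st k) i).2) \o h = w'.
    by apply/funext=> i; rewrite /= hE.
  by rewrite -!A'E; apply: stE.
have Geq x y x' y' : G x y -> G x' y' -> x = x' <-> y = y'.
  move=> xy xy'.
  have := @atomic 2 (FEq (TVar ord0) (TVar ord_max))
    (fun i => if i == ord0 then x else x')
    (fun i => if i == ord0 then y else y').
  apply=> [i|m h]; first by case: ifP.
  by exists (FEq (TVar (h ord0)) (TVar (h ord_max))).
have [g gP] : exists g : M -> M, forall x, G x (g x).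
  suff /choice[g gP] : forall x, exists y, G x y by exists g.
  move=> x; have [i <-] := b_onto x.
  by have [_ _ [y yP] _] := nextP (st i, i) (stE _); exists y, i.+1.
have [g' g'P] : exists g' : M -> M, forall x, G (g' x) x.
  suff /choice[g' g'P] : forall x, exists y, G y x by exists g'.
  move=> x; have [i <-] := b_onto x.
  by have [_ _ _ [y yP]] := nextP (st i, i) (stE _); exists y, i.+1.
have gE x y : G x y -> g x = y by move=> /(Geq _ _ _ _ (gP x)) <-.
exists g; last by move=> x y xy; apply: gE; exists 0.
split.
- exists g' => x; last exact: gE.
  by apply/(Geq _ _ _ _ (g'P (g x)) (gP x)).
- move=> f w; apply: gE.
  have [y yP] : exists y, G (finterp M f w) y by exists (g (finterp M f w)).
  suff <- : y = finterp M f (g \o w) by [].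
  have := @atomic _.+1 (FEq (TVar ord0) (TApp f (fun i => TVar (lift ord0 i))))
    (cons_env (finterp M f w) w) (cons_env y (g \o w)).
  rewrite /= !cons_env0.
  have cE (z : M) u : (fun i => cons_env z u (lift ord0 i)) = u.
    by apply/funext => i; rewrite cons_envS.
  rewrite !cE => H; apply H => // [i|m h].
    by rewrite /cons_env; case: unlift.
  by exists (FEq (TVar (h ord0)) (TApp f (fun i => TVar (h (lift ord0 i))))).
- move=> r w.
  have := @atomic _ (FRel r (fun i => TVar i)) w (g \o w); apply=> // m h.
  by exists (FRel r (fun i => TVar (h i))).
Qed.

End BackAndForth.

Lemma same_type_automorphism S (M : structure S) n (w w' : 'I_n -> M) :
  omega_categorical M -> same_type w w' ->
  exists2 g : M -> M, automorphism g & forall i, g (w i) = w' i.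
Proof.
move=> Mcat ww'; have [_ [Mc Minf] _] := Mcat.
have [x0 _] : [set: M] !=set0 by apply: infinite_setN0.
have [b b_onto] := countable_enumeration x0 Mc.
pose s := [seq (w i, w' i) | i <- enum 'I_n].
have sn : size s = n by rewrite size_ord_map.
have sE : elementary_graph x0 s.
  (* The length of [s] equals [n] only up to a rewriting, so the index bound is generalized before
     the tuples are identified. *)
  suff H m (u u' : 'I_m -> M) : n = m ->
      (forall (i : 'I_n) (j : 'I_m), i = j :> nat ->
         w i = u j /\ w' i = u' j) ->
      same_type u u'.
    by apply: (H _ _ _ (esym sn)) => i j ij; rewrite -ij nth_ord_map.
  move=> nm; case: m / nm u u' => u u' uw.
  have -> : u = w by apply/funext=> i; have [] := uw i i erefl.
  by have -> : u' = w' by apply/funext=> i; have [] := uw i i erefl.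
have [g gA gs] := elementary_graph_automorphism
  (fun n w w' b => @categorical_homogeneous _ _ n w w' b Mcat) b_onto sE.
exists g => // i; apply: gs; apply/mapP; exists i => //; exact: mem_enum.
Qed.

(** * Vectors over M and M' *)

Section Push.
Variable F : fieldType.

(** The linear map induced by a map of bases. For a self-map of [M] it unfolds to [perm_act]. *)
Definition push (T U : choiceType) (h : T -> U) (v : {malg F[T]}) :
    {malg F[U]} :=
  \sum_(x <- msupp v) << v@_x *g h x >>.

Lemma push_widen (T U : choiceType) (h : T -> U) (v : {malg F[T]})
    (d : {fset T}) :
  (msupp v `<=` d)%fset -> push h v = \sum_(x <- d) << v@_x *g h x >>.
Proof.
move=> vd; apply: (big_fset_incl _ vd) => x _ /mcoeff_outdom ->.
by rewrite monalgU0.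
Qed.

Lemma pushD (T U : choiceType) (h : T -> U) : {morph push h : u v / u + v}.
Proof.
move=> u v; pose d := (msupp u `|` msupp v)%fset.
rewrite (push_widen _ (msuppD_le u v)) (@push_widen _ _ h u d) ?fsubsetUl //.
rewrite (@push_widen _ _ h v d) ?fsubsetUr // -big_split.
by apply: eq_bigr => x _; rewrite mcoeffD monalgUD.
Qed.

Lemma push0 (T U : choiceType) (h : T -> U) : push h 0 = 0.
Proof. by rewrite /push msupp0 big_seq_fset0. Qed.

Lemma pushU (T U : choiceType) (h : T -> U) c x :
  push h << c *g x >> = << c *g h x >>.
Proof.
by rewrite (push_widen _ msuppU_le) big_seq_fset1 mcoeffUU.
Qed.

Lemma pushZ (T U : choiceType) (h : T -> U) c v :
  push h (c *: v) = c *: push h v.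
Proof.
rewrite (push_widen _ (msuppZ_le c v)) scaler_sumr.
apply: eq_bigr => x _; apply/malgP => k.
by rewrite mcoeffZ !mcoeffZ !mcoeffU mulrnAr.
Qed.

Lemma push_sum (T U : choiceType) (h : T -> U) (I : Type) (r : seq I) E :
  push h (\sum_(i <- r) E i) = \sum_(i <- r) push h (E i).
Proof. exact: (big_morph _ (@pushD _ _ h) (push0 h)). Qed.

Lemma push_comp (T U V : choiceType) (g : U -> V) (h : T -> U) v :
  push g (push h v) = push (g \o h) v.
Proof.
by rewrite [push h v]/push push_sum; apply: eq_bigr => x _; rewrite pushU.
Qed.

Lemma eq_in_push (T U : choiceType) (h h' : T -> U) v :
  {in msupp v, h =1 h'} -> push h v = push h' v.
Proof. by move=> hh'; apply: eq_big_seq => x /hh' ->. Qed.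

Lemma push_id (T : choiceType) (v : {malg F[T]}) : push id v = v.
Proof. by rewrite [RHS]monalgE. Qed.

Lemma mcoeff_push (T U : choiceType) (h : T -> U) v y :
  (push h v)@_y = \sum_(x <- msupp v) v@_x *+ (h x == y).
Proof.
by rewrite raddf_sum; apply: eq_bigr => x _; rewrite /= mcoeffU.
Qed.

Lemma msupp_push (T U : choiceType) (h : T -> U) v y :
  y \in msupp (push h v) -> exists2 x, x \in msupp v & h x = y.
Proof.
move=> yv; apply: contrapT => none; move: yv.
rewrite -mcoeff_neq0 mcoeff_push big_seq big1 ?eqxx // => x xv.
by case: eqP => // hxy; exfalso; apply: none; exists x.
Qed.

Lemma mcoeff_push_inj (T U : choiceType) (h : T -> U) v x :
  x \in msupp v -> {in msupp v &, injective h} -> (push h v)@_(h x) = v@_x.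
Proof.
move=> xv hI; rewrite mcoeff_push (big_fsetD1 x) //= eqxx.
rewrite big_seq big1 ?addr0 // => z; rewrite !inE => /andP[zx zv].
by case: eqP => // /(hI _ _ zv xv) zxE; rewrite zxE eqxx in zx.
Qed.

End Push.

Section Extension.
Variables (S : language) (M M' : structure S) (iota : M -> M').
Hypotheses (Mcat : omega_categorical M) (iotaE : elementary_embedding iota).
Variable F : fieldType.

Definition partial_elementary (A : {fset M'}) (h : M' -> M) : Prop :=
  forall n (w : 'I_n -> M'), (forall i, w i \in A) -> same_type w (h \o w).

Lemma partial_elementaryS (A B : {fset M'}) h :
  (A `<=` B)%fset -> partial_elementary B h -> partial_elementary A h.
Proof. by move=> /fsubsetP AB Bh n w wA; apply: Bh => i; apply: AB. Qed.

(** Take an elementary copy of [M] inside [M'] that contains [A], and invert its embedding on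
    [A]. *)
Lemma partial_elementary_ex A : exists h, partial_elementary A h.
Proof.
have [_ [_ Minf] _] := Mcat.
have [x0 _] : [set: M] !=set0 by apply: infinite_setN0.
have [f [fE fA _]] := categorical_reflection (fun=> iota x0)
  (tnth (in_tuple (enum_fset A))) Mcat iotaE.
have ex x : exists m, x \in A -> f m = x.
  have [/seq_tnthP[i ->]|] := boolP (x \in A); last by exists x0.
  by have [m fm] := fA i; exists m.
have [h hP] := choice ex; exists h => n w wA B.
rewrite (fE n B (h \o w)); have -> // : f \o (h \o w) = w.
by apply/funext=> i; apply/hP/wA.
Qed.

Lemma partial_elementary_conj A h h' :
  partial_elementary A h -> partial_elementary A h' ->
  exists2 g : M -> M, automorphism g & {in A, g \o h =1 h'}.
Proof.
pose a := tnth (in_tuple (enum_fset A)).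
have aA i : a i \in A by apply: mem_tnth.
move=> /(_ _ a aA) ah /(_ _ a aA) ah'.
have [g gA gh] : exists2 g : M -> M, automorphism g &
    forall i, g ((h \o a) i) = (h' \o a) i.
  by apply: same_type_automorphism => // B; rewrite -(ah B) -(ah' B).
by exists g => // x /seq_tnthP[i ->]; apply: gh.
Qed.

(* The elements of [F M'] all of whose elementary copies in [F M] lie in [W];
   one copy is enough to decide this. *)
Definition ext (W : set {malg F[M]}) : set {malg F[M']} :=
  [set w | exists2 h, partial_elementary (msupp w) h & W (push h w)].

Variable W : set {malg F[M]}.
Hypothesis Wsub : aut_submodule W.

(** Two copies of the support are conjugate under an automorphism of [M], and [W] is stable under
    it. *)
Lemma ext_any w h : ext W w -> partial_elementary (msupp w) h -> W (push h w).
Proof.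
move=> [h' h'E Wh'] hE; have [g gA gh] := partial_elementary_conj h'E hE.
by rewrite -(eq_in_push gh) -push_comp; case: Wsub => _ _ _; apply.
Qed.

Lemma ext0 : ext W 0.
Proof.
have [h hE] := partial_elementary_ex (msupp (0 : {malg F[M']})).
by exists h => //; rewrite push0; case: Wsub.
Qed.

Lemma extD u v : ext W u -> ext W v -> ext W (u + v).
Proof.
move=> Wu Wv.
(* A copy of the union of the supports serves [u], [v] and their sum simultaneously. *)
have [h hE] := partial_elementary_ex (msupp u `|` msupp v)%fset.
exists h; first exact: partial_elementaryS (msuppD_le u v) hE.
rewrite pushD; have [_ WD _ _] := Wsub; apply: WD; apply: ext_any => //.
  exact: partial_elementaryS (fsubsetUl _ _) hE.
exact: partial_elementaryS (fsubsetUr _ _) hE.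
Qed.

Lemma extZ c v : ext W v -> ext W (c *: v).
Proof.
move=> Wv; have [h hE] := partial_elementary_ex (msupp v).
exists h; first exact: partial_elementaryS (msuppZ_le c v) hE.
by rewrite pushZ; have [_ _ WZ _] := Wsub; apply: WZ; apply: ext_any.
Qed.

(** Composing a copy of the support of [v] with the inverse of [xi] gives a copy of the new support
    with the same image in [F M]. *)
Lemma ext_automorphism (xi : M' -> M') v :
  automorphism xi -> ext W v -> ext W (push xi v).
Proof.
move=> xiA; have xiE := isomorphism_elementary xiA.
have [[xi' xiK xi'K] _ _] := xiA.
move=> [h hE Wh]; exists (h \o xi'); last first.
  by rewrite push_comp (@eq_in_push _ _ _ _ h) // => x _ /=; rewrite xiK.
move=> n w wA A.
have wxi : xi \o (xi' \o w) = w by apply/funext=> i; apply: xi'K.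
rewrite -{1}wxi -(xiE n A (xi' \o w)); apply: (hE n (xi' \o w)) => i /=.
by have [x xv <-] := msupp_push (wA i); rewrite xiK.
Qed.

Lemma ext_push_iota v : ext W (push iota v) <-> W v.
Proof.
have iotaI := elementary_embedding_inj iotaE.
have [h hE] := partial_elementary_ex (msupp (push iota v)).
have iotaK x : exists y, forall m, iota m = x -> y = m.
  have [[m <-]|none] := pselect (exists m, iota m = x).
    by exists m => m' /iotaI.
  have [_ [_ Minf] _] := Mcat.
  have [x0 _] : [set: M] !=set0 by apply: infinite_setN0.
  by exists x0 => m mx; exfalso; apply: none; exists m.
(* The inverse [r] of [iota] on its image is an elementary copy of the support and takes the vector
   back to [v]. *)
have [r rP] := choice iotaK.
have rv : push r (push iota v) = v.
  by rewrite push_comp -[RHS]push_id; apply: eq_in_push => x _; apply: rP.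
have rE : partial_elementary (msupp (push iota v)) r.
  move=> n w wA A; rewrite (iotaE A (r \o w)).
  have -> // : iota \o (r \o w) = w.
  apply/funext=> i /=; have [x _ <-] := msupp_push (wA i).
  by rewrite (rP _ x).
split=> [/ext_any/(_ rE)|Wv]; first by rewrite rv.
by exists r => //; rewrite rv.
Qed.

End Extension.

(** * Intervals and well-orders *)

Section CutIntervals.
Variables (T : choiceType) (lt : T -> T -> Prop).
Hypothesis ltL : strict_linear_on setT lt.

Local Notation OT := (order_structure lt).
Local Notation type1 := (set (formula1 OT)).

Let lt_irr x : ~ lt x x. Proof. by have [irr _ _] := ltL; apply: irr. Qed.

Let lt_trans x y z : lt x y -> lt y z -> lt x z.
Proof. by have [_ tr _] := ltL; apply: tr. Qed.

Lemma complete_type_realized2 (q : type1) A B : complete_type q -> q A -> q B ->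
  exists y : T, sat (M := expansion OT) A (fun=> y) /\
                sat (M := expansion OT) B (fun=> y).
Proof.
move=> [fin _] qA qB; have [||y yP] := fin [set A; B].
- exact: finite_set2.
- by move=> C [->|->].
by exists y; split; apply: yP; [left|right].
Qed.

Lemma elt_type_total (q : type1) c : complete_type q -> non_algebraic q ->
  elt_lt_type c q \/ type_lt_elt q c.
Proof.
move=> [fin dec] /(_ c) nc.
have [cq|n1] := dec (f_lt (const lt c) (var_x lt)); first by left.
have [qc|n2] := dec (f_lt (var_x lt) (const lt c)); first by right.
have [/nc //|n3] := dec (f_eq (var_x lt) (const lt c)).
(* Otherwise the three negations lie in [q], and a common realization would violate trichotomy with
   [c]. *)
have [||y yP] := fin [set A | [\/ A = FNot (f_lt (const lt c) (var_x lt)),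
    A = FNot (f_lt (var_x lt) (const lt c)) |
    A = FNot (f_eq (var_x lt) (const lt c))]].
- apply: (sub_finite_set (B := [set FNot (f_lt (const lt c) (var_x lt));
    FNot (f_lt (var_x lt) (const lt c)); FNot (f_eq (var_x lt) (const lt c))])).
    by move=> A [->|->|->]; [left; left|left; right|right].
  by rewrite !finite_setU; split; [split|]; apply: finite_set1.
- by move=> A [->|->|->].
have /= y1 := yP _ (Or31 _ _ erefl).
have /= y2 := yP _ (Or32 _ _ erefl).
have /= y3 := yP _ (Or33 _ _ erefl).
by have [_ _ tot] := ltL; have [/y1|/esym/y3|/y2] := tot c y I I.
Qed.

Lemma elt_type_excl (q : type1) c : complete_type q ->
  elt_lt_type c q -> type_lt_elt q c -> False.
Proof.
move=> qC cq qc; have [y [/= cy yc]] := complete_type_realized2 qC cq qc.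
exact: lt_irr (lt_trans cy yc).
Qed.

Lemma elt_lt_type_trans (q r : type1) c : complete_type q -> complete_type r ->
  non_algebraic r -> elt_lt_type c q -> type_lt q r -> elt_lt_type c r.
Proof.
move=> qC rC rN cq [d [qd dr]].
have [//|rc] := elt_type_total c rC rN.
(* Realizations [y] and [z] would close the cycle c < y < d < z < c. *)
have [y [/= cy yd]] := complete_type_realized2 qC cq qd.
have [z [/= dz zc]] := complete_type_realized2 rC dr rc.
by exfalso; apply: (@lt_irr c); do 3![apply: lt_trans; first by eassumption].
Qed.

Variables (k : nat) (p : 'I_k -> type1).
Hypothesis pC : forall s, complete_type (p s) /\ non_algebraic (p s).
Hypothesis pI : increasing_types p.

Lemma cut_interval_ex x : exists l, cut_interval p l x.
Proof.
(* The interval of [x] is numbered by the least [s] with x < p_s, or by [k] when there is none. *)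
pose P n := `[< n = k \/
  exists s : 'I_k, s = n :> nat /\ elt_lt_type x (p s) >].
have exP : exists n, P n by exists k; apply/asboolP; left.
case: (ex_minnP exP) => m /asboolP Pm mmin.
have mk : (m < k.+1)%N by apply: mmin; apply/asboolP; left.
exists (Ordinal mk); split=> s /= sm.
  have [pC' pN] := pC s; have [xs|//] := elt_type_total x pC' pN.
  have : (m <= s)%N by apply: mmin; apply/asboolP; right; exists s.
  by rewrite -sm ltnn.
case: Pm => [mE|[s' [s'm]]]; first by have := ltn_ord s; rewrite sm mE ltnn.
by have -> : s' = s by apply: val_inj; rewrite /= sm.
Qed.

Lemma cut_interval_uniq x l l' :
  cut_interval p l x -> cut_interval p l' x -> l = l'.
Proof.
wlog ll' : l l' / (l < l')%N.
  move=> H lx l'x; have [ll'|l'l|/val_inj //] := ltngtP l l'; first exact: H.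
  by apply/esym/H.
move=> [_ lx] [l'x _]; exfalso.
(* Membership in both intervals gives x < p_l and p_(l'-1) < x, while l <= l'-1. *)
have lk : (l < k)%N by apply: leq_trans ll' _; rewrite -ltnS.
have l'k : (l'.-1 < k)%N.
  by move: (ltn_ord l') ll'; case: (nat_of_ord l').
have {lx}lx := lx (Ordinal lk) erefl.
have {l'x}l'x : type_lt_elt (p (Ordinal l'k)) x.
  by apply: l'x; rewrite /= prednK //; apply: leq_ltn_trans ll'.
apply: elt_type_excl (pC _).1 _ l'x.
have : (l <= l'.-1)%N by rewrite -ltnS prednK //; apply: leq_ltn_trans ll'.
rewrite leq_eqVlt => /orP[/eqP lE|lt'].
  suff <- : Ordinal lk = Ordinal l'k by [].
  exact: val_inj.
by apply: elt_lt_type_trans lx (pI _) => //; apply (pC _).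
Qed.

End CutIntervals.

Lemma strict_linear_onS (T : Type) (D D' : set T) (R : T -> T -> Prop) :
  D' `<=` D -> strict_linear_on D R -> strict_linear_on D' R.
Proof.
move=> D'D [irr tr tot]; split=> [x /D'D|x y z /D'D xD /D'D yD /D'D zD|
  x y /D'D xD /D'D yD]; [exact: irr|exact: tr|exact: tot].
Qed.

(** The bound lies in [D] even when [s] misses [D]: a tuple needs an entry in every nonempty
    interval, including those that a support does not meet. *)
Lemma finite_max (T : eqType) (D : set T) (R : T -> T -> Prop) (s : seq T) :
  strict_linear_on D R -> D !=set0 ->
  exists2 b, D b & forall x, x \in s -> D x -> x = b \/ R x b.
Proof.
move=> [irr tr tot] [d Dd]; elim: s => [|x s [b Db bP]]; first by exists d.
have [Dx|nDx] := pselect (D x); last first.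
  by exists b => // y; rewrite inE => /predU1P[-> //|]; apply: bP.
have [xb|xb|bx] := tot x b Dx Db.
- exists b => // y; rewrite inE => /predU1P[-> _|]; [by right|exact: bP].
- exists b => // y; rewrite inE => /predU1P[-> _|]; [by left|exact: bP].
exists x => // y; rewrite inE => /predU1P[-> _|ys Dy]; first by left.
by right; have [->//|yb] := bP y ys Dy; apply: tr bx.
Qed.

Section LexicographicSum.
Variables (T : choiceType) (K : nat) (idx : T -> 'I_K).
Variable R : 'I_K -> T -> T -> Prop.
Hypothesis R_wo : forall l, [set x | idx x = l] !=set0 ->
  well_ordered_on [set x | idx x = l] (R l).

Definition prec (x y : T) : Prop :=
  (idx x < idx y)%N \/ (idx x = idx y /\ R (idx x) x y).

Lemma prec_well_ordered : well_ordered_on setT prec.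
Proof.
have lin l x : idx x = l -> strict_linear_on [set x | idx x = l] (R l).
  by move=> xl; have [] := @R_wo l; first by exists x.
split.
  split=> [x _|x y z _ _ _|x y _ _].
  - case=> [|[_]]; first by rewrite ltnn.
    by have [irr _ _] := lin _ x erefl; apply: irr.
  - move=> [xy|[xy Rxy]] [yz|[yz Ryz]]; rewrite /prec.
    + by left; apply: ltn_trans xy yz.
    + by left; rewrite -yz.
    + by left; rewrite xy.
    right; split; first by rewrite xy.
    have [_ tr _] := lin _ x erefl; apply: (tr x y z) => //=;
      last by rewrite xy.
    by rewrite xy yz.
  - have [xy|yx|/val_inj xy] := ltngtP (idx x) (idx y).
    + by apply: Or31; left.
    + by apply: Or33; left.
    have [_ _ tot] := lin _ x erefl; have [||||] := tot x y => //=.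
    + by move=> Rxy; apply: Or31; right.
    + exact: Or32.
    + by move=> Ryx; apply: Or33; right; rewrite -xy.
move=> B _ [b0 Bb0].
pose P n := `[< exists2 x, B x & idx x = n :> nat >].
have exP : exists n, P n by exists (idx b0); apply/asboolP; exists b0.
case: (ex_minnP exP) => m /asboolP[x Bx xm] mmin.
have [|_ wo] := @R_wo (idx x); first by exists x.
have [||b [Bb bx] bmin] := wo [set y | B y /\ idx y = idx x].
- by move=> y [].
- by exists x.
exists b => // y By; have : (m <= idx y)%N.
  by apply: mmin; apply/asboolP; exists y.
rewrite leq_eqVlt -xm => /predU1P[/val_inj xy|xy].
  have [->|Rby] := bmin y (conj By (esym xy)); first by left.
  by right; right; rewrite bx.
by right; left; rewrite bx.
Qed.

End LexicographicSum.

(** * Monotone subsequences *)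

Definition increasing_seq (f : nat -> nat) : Prop :=
  forall i j, (i < j)%N -> (f i < f j)%N.

Lemma increasing_seqP f : (forall i, (f i < f i.+1)%N) -> increasing_seq f.
Proof.
move=> fS i j /subnKC <-; elim: (j - i.+1)%N => [|n IH]; first by rewrite addn0.
by rewrite addnS; apply: ltn_trans IH _.
Qed.

(* The index relation [x_i <= x_j] of a sequence in a well-order. *)
Definition well_founded_index (r : nat -> nat -> Prop) : Prop :=
  forall B : set nat, B !=set0 -> exists2 m, B m & forall j, B j -> r m j.

Lemma well_founded_index_nat (f : nat -> nat) :
  well_founded_index (fun i j => (f i <= f j)%N).
Proof.
move=> B [b Bb].
pose P n := `[< exists2 i, B i & f i = n >].
have exP : exists n, P n by exists (f b); apply/asboolP; exists b.
case: (ex_minnP exP) => _ /asboolP[i Bi <-] imin; exists i => // j Bj.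
by apply: imin; apply/asboolP; exists j.
Qed.

Lemma well_founded_index_order (T : Type) (D : set T) R (x : nat -> T) :
  well_ordered_on D R -> (forall i, D (x i)) ->
  well_founded_index (fun i j => x i = x j \/ R (x i) (x j)).
Proof.
move=> [_ wo] Dx B [b Bb].
have [||_ [i Bi <-] imin] := wo (x @` B).
- by move=> _ [i _ <-].
- by exists (x b), b.
by exists i => // j Bj; have [->|] := imin (x j) (imageP x Bj); [left|right].
Qed.

Lemma monotone_subsequence r f : well_founded_index r -> increasing_seq f ->
  exists2 g, increasing_seq g &
    forall i j, (i < j)%N -> r (f (g i)) (f (g j)).
Proof.
move=> rW fI.
have ex n : exists m, (n <= m)%N /\ forall j, (n <= j)%N -> r (f m) (f j).
  have [|_ [m nm <-] mP] := rW (f @` [set j | (n <= j)%N]).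
    by exists (f n), n => /=.
  by exists m; split=> // j nj; apply/mP/imageP.
have [h hP] := choice ex.
(* Each new position carries a least value among all positions after the previous one, so it lies
   below all later choices. *)
pose g := fix g i := if i is i'.+1 then h (g i').+1 else h 0.
have gS i : (g i < g i.+1)%N by have [] := hP (g i).+1.
have gI := increasing_seqP gS; exists g => // i j ij.
case: i ij => [|i] ij; first exact: (hP 0).2.
by apply: (hP _).2; apply: ltn_trans (gI _ _ ij); apply: gS.
Qed.

Lemma monotone_subsequences (I : eqType) (s : seq I)
    (r : I -> nat -> nat -> Prop) f :
  (forall l, well_founded_index (r l)) -> increasing_seq f ->
  exists2 g, increasing_seq g & forall l, l \in s ->
    forall i j, (i < j)%N -> r l (f (g i)) (f (g j)).
Proof.
move=> rW fI; elim: s => [|l s [g gI gP]]; first by exists id.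
have fgI : increasing_seq (f \o g) by move=> i j ij; apply/fI/gI.
have [h hI hP] := monotone_subsequence (rW l) fgI.
exists (g \o h); first by move=> i j ij; apply/gI/hI.
move=> l'; rewrite inE => /predU1P[-> //|l's] i j ij.
by apply: gP => //; apply: hI.
Qed.

(** * Generated submodules *)

Section Spans.
Variables (S : language) (M : structure S) (F : fieldType).
Implicit Type X : set {malg F[M]}.

Lemma aut_span_submodule X : aut_submodule (aut_span X).
Proof.
split=> [W [[W0 _ _ _] _] //|u v Xu Xv W [Wsub XW]|c v Xv W [Wsub XW]|
  g v gA Xv W [Wsub XW]]; have [_ WD WZ WA] := Wsub.
- by apply: WD; [apply: Xu|apply: Xv].
- by apply: WZ; apply: Xv.
- by apply: WA => //; apply: Xv.
Qed.

Lemma aut_span_min X W : aut_submodule W -> X `<=` W -> aut_span X `<=` W.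
Proof. by move=> Wsub XW v; apply. Qed.

Lemma sub_aut_span X : X `<=` aut_span X.
Proof. by move=> v Xv W [_]; apply. Qed.

End Spans.

(** * Reduction of leading terms *)

Lemma msupp_ex (T : choiceType) (F : fieldType) (u : {malg F[T]}) :
  u != 0 -> exists x, x \in msupp u.
Proof.
move=> u0; apply/fset0Pn; apply: contra u0 => /eqP u0.
by rewrite (monalgE u) u0 big_seq_fset0.
Qed.

Section LeadingTerms.
Variables (T : choiceType) (F : fieldType) (prec : T -> T -> Prop).
Hypothesis precW : well_ordered_on setT prec.

Definition leads (u : {malg F[T]}) (y : T) : Prop :=
  y \in msupp u /\ forall x, x \in msupp u -> x = y \/ prec x y.

Lemma leads_ex (u : {malg F[T]}) : u != 0 -> exists y, leads u y.
Proof.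
move=> /msupp_ex[x xu].
have lin : strict_linear_on [set z | z \in msupp u] prec.
  by apply: strict_linear_onS precW.1.
have [|y yu ymax] := finite_max (msupp u) lin; first by exists x.
by exists y; split=> // z zu; apply: ymax.
Qed.

Lemma minimal_leads (Y : set {malg F[T]}) : Y !=set0 -> ~ Y 0 ->
  exists u y, [/\ Y u, leads u y &
    forall u' y', Y u' -> leads u' y' -> ~ prec y' y].
Proof.
move=> [u0 Yu0] Y0; have [lin wo] := precW; have [irr tr _] := lin.
have nz u : Y u -> u != 0 by move=> Yu; apply/eqP => u00; rewrite u00 in Yu.
have [y0 y0P] := leads_ex (nz _ Yu0).
have [||y [u Yu uy] ymin] := wo [set y | exists2 u, Y u & leads u y] => //.
  by exists y0, u0.
exists u, y; split=> // u' y' Yu' u'y' y'y.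
have [|y'E|yy'] := ymin y'; first by exists u'.
  by apply: (irr y I); rewrite -{1}y'E.
exact: irr y I (tr _ _ _ I I I yy' y'y).
Qed.

Lemma leads_reduce (u w : {malg F[T]}) y :
  leads u y -> leads w y -> exists c, forall y',
    leads (u - c *: w) y' -> prec y' y.
Proof.
move=> [yu umax] [yw wmax]; exists (u@_y / w@_y) => y' [y'd _].
have y'uw : y' = y \/ prec y' y.
  have /fsubsetP/(_ y' y'd) := msuppB_le u ((u@_y / w@_y) *: w).
  rewrite in_fsetU => /orP[/umax //|y'w]; apply: wmax.
  by have /fsubsetP := msuppZ_le (u@_y / w@_y) w; apply.
case: y'uw => // y'y; move: y'd.
rewrite y'y -mcoeff_neq0 mcoeffB mcoeffZ divfK ?subrr ?eqxx //.
by rewrite mcoeff_neq0.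
Qed.

End LeadingTerms.

Theorem theorem3p7 (S : language) (M : structure S) (F : fieldType)
    (v : nat -> {malg F[M]}) :
  omega_categorical M ->
  (forall i : nat,
     aut_span (range v) <> aut_span [set v j | j in [set j | (j < i)%N]]) ->
  forall (M' : structure S) (iota : M -> M'), elementary_embedding iota ->
  ~ exists (L : set M') (lt : L -> L -> Prop) (k : nat)
      (p : 'I_k -> set (formula1 (order_structure lt))),
    [/\ forall i x, x \in msupp (v i) -> L (iota x),
        strict_linear_on setT lt,
        (forall s, complete_type (p s) /\ non_algebraic (p s)) /\
          increasing_types p,
        quasi_well_ordered p &
        nice p].
Proof.
move=> Mcat vgen M' iota iotaE [L [lt [k [p [vL ltL [pC pI] _ [e eW niceL]]]]]].
pose W n := aut_span [set v j | j in [set j | (j < n)%N]].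
have Wsub n : aut_submodule (W n) by apply: aut_span_submodule.
have WS m n : (m <= n)%N -> W m `<=` W n.
  move=> mn; apply: aut_span_min => // _ [j jm <-]; apply: sub_aut_span.
  by exists j => //; apply: leq_trans mn.
have vW m : W m.+1 (v m) by apply: sub_aut_span; exists m => //=.
have Wproper n : exists m, ~ W n (v m).
  apply: contrapT => none; apply: (vgen n); apply/seteqP; split.
    apply: (aut_span_min (Wsub n)) => _ [m _ <-]; apply: contrapT => nv.
    by apply: none; exists m.
  apply: aut_span_min => [|_ [j _ <-]]; first exact: aut_span_submodule.
  by apply: sub_aut_span; exists j.
pose E n := ext (M' := M') (W n).
have ES m n : (m <= n)%N -> E m `<=` E n.
  by move=> mn u [h hE Wu]; exists h => //; apply: (WS m n).
have [idx idxP] := choice (cut_interval_ex ltL pC).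
have idx_uniq x l : cut_interval p l x -> idx x = l.
  by move=> xl; apply: (cut_interval_uniq ltL pC pI (idxP x) xl).
have cutE l : cut_interval p l = [set x | idx x = l].
  by apply/seteqP; split=> x /= => [/idx_uniq|<-].
pose R l := lt_towards (p (e l)).
have RW l : [set x | idx x = l] !=set0 ->
    well_ordered_on [set x | idx x = l] (R l).
  by rewrite -cutE => /eW[].
pose pr := prec idx R.
have prW : well_ordered_on setT pr by apply: prec_well_ordered.
(* The candidates at level [n]: vectors over [L] that lie in some [E m] but not in [E n]. *)
pose Y n := [set u : {malg F[L]} |
  (exists m, E m (push val u)) /\ ~ E n (push val u)].
have Y0 n : ~ Y n 0.
  by move=> [_]; apply; rewrite push0; apply: (ext0 Mcat iotaE).
have Yex n : Y n !=set0.
  have [m nWm] := Wproper n.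
  have /msupp_ex[x0 x0v] : v m != 0.
    by apply/eqP => vm0; apply: nWm; rewrite vm0; case: (Wsub n).
  (* The support of [v m] is lifted to [L]; outside the support the lift takes the value of [x0]. *)
  have ex x : exists t : L, x \in msupp (v m) -> val t = iota x.
    have [xv|_] := boolP (x \in msupp (v m)).
      by exists (exist _ (iota x) (mem_set (vL _ _ xv))).
    by exists (exist _ (iota x0) (mem_set (vL _ _ x0v))).
  have [th thP] := choice ex.
  have thE : push val (push th (v m)) = push iota (v m).
    by rewrite push_comp; apply: eq_in_push => x /thP.
  exists (push th (v m)); rewrite /Y /= thE.
  split; last by rewrite /E ext_push_iota.
  by exists m.+1; rewrite /E ext_push_iota.
(* For each [n]: a candidate [u] with minimal leading element [y], a level [N] containing it, and a
   tuple [b] bounding its support in each nonempty interval, with [y] itself as the entry in the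
   interval of [y]. *)
have data n : exists d : {malg F[L]} * L * nat * ('I_k.+1 -> L),
    let: (u, y, N, b) := d in
    [/\ Y n u, leads pr u y, E N (push val u),
        forall u' y', Y n u' -> leads pr u' y' -> ~ pr y' y &
        b (idx y) = y /\ forall l, cut_interval p l !=set0 ->
          cut_interval p l (b l) /\
          forall x, x \in msupp u -> idx x = l -> x = b l \/ R l x (b l)].
  have [u [y [Yu uy ymin]]] := minimal_leads prW (Yex n) (@Y0 n).
  have [[N EN] _] := Yu.
  have exb l : exists b, (idx y = l -> b = y) /\ (cut_interval p l !=set0 ->
      cut_interval p l b /\
      forall x, x \in msupp u -> idx x = l -> x = b \/ R l x b).
    have [<-|ly] := pselect (idx y = l).
      exists y; split=> // _; split=> [|x xu xl]; first exact: idxP.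
      have [_ /(_ x xu)[|[|[]]]] := uy; first by left.
        by rewrite xl ltnn.
      by right; rewrite -xl.
    have [Jl|] := pselect (cut_interval p l !=set0); last by exists y.
    rewrite cutE in Jl.
    have [b bl bmax] := finite_max (msupp u) (RW l Jl).1 Jl.
    by exists b; split=> // _; split=> //; rewrite cutE.
  have [b bP] := choice exb; exists (u, y, N, b); split=> //.
  by split=> [|l Jl]; [apply: (bP _).1|apply: (bP _).2].
have [dd ddP] := choice data.
pose u n := (dd n).1.1.1; pose y n := (dd n).1.1.2.
pose N n := (dd n).1.2; pose b n := (dd n).2.
have dP n : [/\ Y n (u n), leads pr (u n) (y n), E (N n) (push val (u n)),
        forall u' y', Y n u' -> leads pr u' y' -> ~ pr y' (y n) &
        b n (idx (y n)) = y n /\ forall l, cut_interval p l !=set0 ->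
          cut_interval p l (b n l) /\
          forall x, x \in msupp (u n) -> idx x = l ->
            x = b n l \/ R l x (b n l)].
  by have := ddP n; rewrite /u /y /N /b; case: (dd n) => [[[]]].
(* The levels grow fast enough that each chosen vector lies in [E n] for every later level [n] of
   the sequence. *)
pose f0 := fix f i := if i is i'.+1 then (maxn (N (f i')) (f i')).+1 else 0%N.
have f0I : increasing_seq f0.
  by apply: increasing_seqP => i; rewrite /= ltnS leq_maxr.
have f0N i j : (i < j)%N -> (N (f0 i) <= f0 j)%N.
  move=> ij; have : (f0 i.+1 <= f0 j)%N.
    move: ij; rewrite leq_eqVlt => /predU1P[-> //|/f0I]; exact: ltnW.
  by apply: leq_trans; rewrite /= leqW // leq_maxl.
(* Besides the tuple entries, the interval number of [y] is made monotone in both directions, by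
   comparing it and its complement to [k]. It is therefore constant on the subsequence. *)
pose r (c : 'I_k.+1 + bool) i j : Prop := match c with
  | inl l => cut_interval p l !=set0 -> b i l = b j l \/ R l (b i l) (b j l)
  | inr true => (idx (y i) <= idx (y j))%N
  | inr false => (k - idx (y i) <= k - idx (y j))%N end.
have rW c : well_founded_index (r c).
  case: c => [l|[]]; try exact: well_founded_index_nat.
  have [Jl|nJ] := pselect (cut_interval p l !=set0); last first.
    by move=> B [i Bi]; exists i => // j _ /nJ.
  have bJ i : cut_interval p l (b i l).
    by have [_ _ _ _ [_ /(_ l Jl)[]]] := dP i.
  move=> B B0; have [m Bm mP] := well_founded_index_order (eW l Jl).2 bJ B0.
  by exists m => // j Bj _; apply: mP.
have [g gI gP] := monotone_subsequences (enum {: 'I_k.+1 + bool}) rW f0I.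
pose s i := f0 (g i).
have sP c i j : (i < j)%N -> r c (s i) (s j) by apply: gP; rewrite mem_enum.
have idxs i j : (i < j)%N -> idx (y (s i)) = idx (y (s j)).
  move=> ij; apply: val_inj; apply/eqP; rewrite eqn_leq.
  have /= -> := sP (inr true) i j ij.
  have /= := sP (inr false) i j ij.
  by rewrite leq_sub2lE // -ltnS.
have [i [j [xi [ij xiA xib xilow]]]] : exists (i j : nat) (xi : M' -> M'),
    [/\ (i < j)%N, automorphism xi,
     forall l, cut_interval p l !=set0 ->
       xi (val (b (s i) l)) = val (b (s j) l) &
     forall l x, cut_interval p l x -> R l x (b (s i) l) ->
       exists y : L,
         [/\ xi (val x) = val y, cut_interval p l y & R l y (b (s j) l)]].
  apply: (niceL (fun i => b (s i))) => [i l Jl|i l Jl].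
    by have [_ _ _ _ [_ /(_ l Jl)[]]] := dP (s i).
  exact: (sP (inl l)).
have [Yi ui Ei mini [byi bi]] := dP (s i).
have [Yj uj Ej minj [byj bj]] := dP (s j).
(* On the support of the earlier vector [xi] stays in [L], keeps the interval, and lands weakly
   below the entry of the later tuple. *)
have img x : exists z, x \in msupp (u (s i)) ->
    xi (val x) = val z /\ idx z = idx x /\
    (z = b (s j) (idx x) \/ R (idx x) z (b (s j) (idx x))).
  have [xu|] := boolP (x \in msupp (u (s i))); last by exists x.
  have Jx : cut_interval p (idx x) !=set0 by exists x; apply: idxP.
  have [_ /(_ x xu erefl)[xb|xb]] := bi _ Jx.
    exists (b (s j) (idx x)) => _; split; first by rewrite {1}xb xib.
    by split; [apply: idx_uniq; apply: (bj _ Jx).1|left].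
  have [z [xiz zJ zb]] := xilow _ _ (idxP x) xb.
  by exists z => _; split=> //; split; [apply: idx_uniq|right].
have [eta etaP] := choice img.
pose w := push eta (u (s i)).
have xiI : injective xi by have [/bij_inj] := xiA.
have wE : push val w = push xi (push val (u (s i))).
  by rewrite !push_comp; apply: eq_in_push => x /etaP[xE _] /=.
have etaI : {in msupp (u (s i)) &, injective eta}.
  move=> x x' /etaP[xE _] /etaP[x'E _] /(congr1 val); rewrite -xE -x'E.
  by move=> /xiI/val_inj.
have yJ n : cut_interval p (idx (y n)) !=set0 by exists (y n); apply: idxP.
(* Both leading elements are the entries of their tuples at the same interval, and [xi] matches
   these entries. *)
have etay : eta (y (s i)) = y (s j).
  apply: val_inj; have [/etaP[<- _] _] := ui.
  by rewrite -{1}byi xib // (idxs i j ij) byj.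
(* Elements of earlier intervals stay there because [eta] preserves [idx]; in the interval of the
   leading element the bound by the later tuple applies. *)
have wlead : leads pr w (y (s j)).
  have [yu umax] := ui; split.
    by rewrite -mcoeff_neq0 -etay (mcoeff_push_inj yu etaI) mcoeff_neq0.
  move=> _ /msupp_push[x xu <-]; have [_ [idxx etax]] := etaP x xu.
  have [xy|[xy|[xy _]]] := umax x xu.
  - by left; rewrite xy.
  - by right; left; rewrite idxx -(idxs i j ij).
  move: etax; rewrite xy (idxs i j ij) byj => -[->|Rx]; first by left.
  by right; right; rewrite idxx xy (idxs i j ij).
have [c cP] := leads_reduce uj wlead.
have Ew n : E n (push val (u (s i))) -> E n (push val w).
  by rewrite wE; apply: ext_automorphism.
(* The level of the earlier vector is at most [s j] by the growth of [f0], and [xi] preserves the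
   extended submodule. *)
have Esj : E (s j) (push val w).
  by apply: Ew; apply: ES Ei; apply: f0N; apply: gI.
have Yd : Y (s j) (u (s j) - c *: w).
  rewrite /Y /= -scaleNr pushD pushZ; have [_ nE] := Yj; split.
    exists (maxn (N (s j)) (s j)); apply: (extD Mcat iotaE) => //.
      exact: ES (leq_maxl _ _) _ Ej.
    by apply: (extZ Mcat iotaE) => //; apply: ES (leq_maxr _ _) _ Esj.
  (* As [w] lies in [E (s j)], the difference cannot lie there without bringing [u (s j)] along. It
     is thus a candidate with a smaller leading element. *)
  move=> Ed; apply: nE; rewrite -[push val _](subrK (c *: push val w)) -scaleNr.
  by apply: (extD Mcat iotaE) => //; apply: (extZ Mcat iotaE).
have /leads_ex : u (s j) - c *: w != 0.
  by apply/eqP => d0; apply: (@Y0 (s j)); rewrite -d0.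
move=> /(_ _ prW)[y' y'lead].
exact: minj Yd y'lead (cP y' y'lead).
Qed.
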